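(* Let $K$ be a field, $P_0=K[x_1,\dots,x_m]$ with graded maximal ideal $\mathfrak m=(x_1,\dots,x_m)$, $P=K[x_1,\dots,x_m,y_1,\dots,y_n]$ bigraded by $\deg x_i=(1,0)$, $\deg y_j=(0,1)$, and $P_+=(y_1,\dots,y_n)$. Let $f\in P$ be a bihomogeneous polynomial such that $I(f)$ is $\mathfrak m$-primary, and let $R=P/fP$. Then the regularity of $H^n_{P_+}(R)_j$ is linearly bounded in $j$; that is, there exist integers $A,B$ such that $\operatorname{reg} H^n_{P_+}(R)_j\le -Aj+B$ for all $j\le -n$.
   Context: Writing $f=\sum_\beta f_\beta y^\beta$ with $f_\beta\in P_0$, $I(f)\subseteq P_0$ is the ideal generated by all the coefficients $f_\beta$. For a bigraded $P$-module $N$, $N_j=\bigoplus_i N_{(i,j)}$ is a graded $P_0$-module with $(N_j)_i=N_{(i,j)}$. $H^n_{P_+}(R)$ is local cohomology with its natural bigrading; each $H^n_{P_+}(R)_j$ is a finitely generated graded $P_0$-module (zero for $j>-n$). $\operatorname{reg}$ denotes Castelnuovo-Mumford regularity over $P_0$, with $\operatorname{reg} 0=-\infty$. *)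

(* Defs.v *)
From HB Require Import structures.
From mathcomp Require Import all_boot all_order all_algebra.
From mathcomp Require Import generic_quotient ring_quotient zify.
From mathcomp Require Import boolp mpoly classical_sets constructive_ereal.

Set Implicit Arguments.
Unset Strict Implicit.
Unset Printing Implicit Defensive.

Import Order.TTheory GRing.Theory Num.Theory.
Local Open Scope ring_scope.
Local Open Scope quotient_scope.
Local Open Scope classical_set_scope.

Section Ideals.
Variable A : comNzRingType.

Definition ideal_gen (s : seq A) : set A :=
  [set a | exists c : 'I_(size s) -> A, a = \sum_(i < size s) c i * s`_i].

Definition ideal_radical (I : set A) : set A := [set a | exists k, I (a ^+ k)].

Definition primary_ideal (I : set A) : Prop :=
  ~ I 1 /\ forall a b, I (a * b) -> I a \/ exists k, I (b ^+ k).

Definition ideal_is_primary_to (J I : set A) : Prop :=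
  primary_ideal I /\ ideal_radical I = J.

End Ideals.

Section QuotientModule.
Variables (A : pzRingType) (V : lmodType A) (W : submodClosed V).

Let W_zmod_closed : zmod_closed W.
Proof. exact: GRing.submod_closedB (submodClosedP W). Qed.

(* [Quotient.quot] wants a [zmodClosed], to which a [submodClosed] does not
   coerce because the latter is also meant for semimodules. *)
Let WZ : zmodClosed V :=
  HB.pack (GRing.SubmodClosed.sort W)
  (GRing.isZmodClosed.Build V (GRing.SubmodClosed.sort W) W_zmod_closed).

Definition quotmod : Type := Quotient.quot WZ.
HB.instance Definition _ := GRing.Zmodule.on quotmod.

Definition quotmod_pi (v : V) : quotmod := \pi_(Quotient.quot WZ) v.

Lemma quotmod_piP (u v : V) : quotmod_pi u = quotmod_pi v <-> u - v \in W.
Proof.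
by split=> [/eqP|uv]; [|apply/eqP]; rewrite -Quotient.idealrBE.
Qed.

Lemma quotmod_pi_zmod_morphism : zmod_morphism quotmod_pi.
Proof. by move=> u v; rewrite /quotmod_pi raddfB. Qed.

Lemma quotmod_pi_surj (x : quotmod) : exists v, x = quotmod_pi v.
Proof. by exists (repr (x : Quotient.quot WZ)); rewrite /quotmod_pi reprK. Qed.

Definition quotmod_scale (a : A) (x : quotmod) : quotmod :=
  quotmod_pi (a *: repr (x : Quotient.quot WZ)).

Lemma quotmod_scaleE a v : quotmod_scale a (quotmod_pi v) = quotmod_pi (a *: v).
Proof.
apply/quotmod_piP; rewrite -scalerBr rpredZ //.
by apply/quotmod_piP; rewrite /quotmod_pi reprK.
Qed.

Let piD u v : quotmod_pi u + quotmod_pi v = quotmod_pi (u + v).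
Proof. by rewrite /quotmod_pi raddfD. Qed.

Let scaleA a b x :
  quotmod_scale a (quotmod_scale b x) = quotmod_scale (a * b) x.
Proof. by have [v ->] := quotmod_pi_surj x; rewrite !quotmod_scaleE scalerA. Qed.

Let scale1 : left_id 1 quotmod_scale.
Proof.
by move=> x; have [v ->] := quotmod_pi_surj x; rewrite quotmod_scaleE scale1r.
Qed.

Let scaleDr : right_distributive quotmod_scale +%R.
Proof.
move=> a x y; have [u ->] := quotmod_pi_surj x; have [v ->] := quotmod_pi_surj y.
by rewrite piD !quotmod_scaleE piD scalerDr.
Qed.

Let scaleDl x : {morph quotmod_scale^~ x : a b / a + b}.
Proof.
by move=> a b; have [v ->] := quotmod_pi_surj x; rewrite !quotmod_scaleE piD scalerDl.
Qed.

HB.instance Definition _ := GRing.Zmodule_isLmodule.Build A quotmod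
  scaleA scale1 scaleDr scaleDl.

Lemma quotmod_pi_scalable : scalable quotmod_pi.
Proof. by move=> a v; rewrite -quotmod_scaleE. Qed.

HB.instance Definition _ :=
  GRing.isZmodMorphism.Build V quotmod quotmod_pi quotmod_pi_zmod_morphism.
HB.instance Definition _ :=
  GRing.isScalable.Build A V quotmod *:%R quotmod_pi quotmod_pi_scalable.

End QuotientModule.

Definition restrict_scalars (A B : pzRingType) (h : {rmorphism A -> B})
  (V : lmodType B) : Type := V.

Section RestrictScalars.
Variables (A B : pzRingType) (h : {rmorphism A -> B}) (V : lmodType B).

HB.instance Definition _ := GRing.Zmodule.copy (restrict_scalars h V) V.

Definition restr_scale (a : A) (v : restrict_scalars h V) : restrict_scalars h V :=
  h a *: (v : V).

Let scaleA a b v : restr_scale a (restr_scale b v) = restr_scale (a * b) v.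
Proof. by rewrite /restr_scale scalerA rmorphM. Qed.

Let scale1 : left_id 1 restr_scale.
Proof. by move=> v; rewrite /restr_scale rmorph1 scale1r. Qed.

Let scaleDr : right_distributive restr_scale +%R.
Proof. by move=> a u v; rewrite /restr_scale scalerDr. Qed.

Let scaleDl v : {morph restr_scale^~ v : a b / a + b}.
Proof. by move=> a b; rewrite /restr_scale rmorphD scalerDl. Qed.

HB.instance Definition _ := GRing.Zmodule_isLmodule.Build A (restrict_scalars h V)
  scaleA scale1 scaleDr scaleDl.

End RestrictScalars.

Section Localization.
Variables (A : comPzRingType) (M : lmodType A) (s : A).

(* (m, k) stands for the fraction m / s^k. *)
Definition loc_rel (x y : M * nat) : bool :=
  `[< exists l, s ^+ (l + y.2) *: x.1 = s ^+ (l + x.2) *: y.1 >].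

Let loc_relP x y : reflect
  (exists l, s ^+ (l + y.2) *: x.1 = s ^+ (l + x.2) *: y.1) (loc_rel x y).
Proof. exact: asboolP. Qed.

Lemma loc_rel_equiv : equiv_class_of loc_rel.
Proof.
have sym x y : loc_rel x y -> loc_rel y x.
  by move=> /loc_relP[l e]; apply/loc_relP; exists l.
split=> [x|x y|y x z].
- by apply/loc_relP; exists 0%N.
- by apply/idP/idP; apply: sym.
case: x y z => [x kx] [y ky] [z kz].
move=> /loc_relP[l /= e] /loc_relP[l' /= e']; apply/loc_relP => /=.
exists (l + l' + ky)%N.
have -> : (l + l' + ky + kz = (l' + kz) + (l + ky))%N by lia.
rewrite exprD -scalerA e scalerA -exprD.
have -> : (l' + kz + (l + kx) = (l + kx) + (l' + kz))%N by lia.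
rewrite exprD -scalerA e' scalerA -exprD; congr (s ^+ _ *: _); lia.
Qed.

Canonical loc_rel_equivPack := EquivRelPack loc_rel_equiv.
Canonical loc_rel_encModRel := defaultEncModRel loc_rel.

Definition loc : Type := {eq_quot loc_rel}.
HB.instance Definition _ := Choice.on loc.

Definition frac (m : M) (k : nat) : loc := \pi_({eq_quot loc_rel}) (m, k).

Lemma fracP m k m' k' : frac m k = frac m' k' <->
  exists l, s ^+ (l + k') *: m = s ^+ (l + k) *: m'.
Proof.
split=> [/eqmodP/loc_relP //|e]; apply/eqmodP; exact/loc_relP.
Qed.

Definition loc_repr (x : loc) : M * nat := repr (x : {eq_quot loc_rel}).

Lemma loc_reprK x : frac (loc_repr x).1 (loc_repr x).2 = x.
Proof. by rewrite /frac -surjective_pairing /loc_repr reprK. Qed.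

Lemma loc_ind (P : loc -> Prop) : (forall m k, P (frac m k)) -> forall x, P x.
Proof. by move=> PF x; rewrite -(loc_reprK x). Qed.

Lemma frac_expand l m k : frac (s ^+ l *: m) (l + k) = frac m k.
Proof. by apply/fracP; exists 0%N; rewrite scalerA -exprD !add0n addnC. Qed.

Lemma frac_common x y :
  exists k m m', x = frac m k /\ y = frac m' k.
Proof.
elim/loc_ind: x => m k; elim/loc_ind: y => m' k'.
exists (k' + k)%N, (s ^+ k' *: m), (s ^+ k *: m').
by rewrite frac_expand addnC frac_expand.
Qed.

Definition loc_add (x y : loc) : loc :=
  let: ((m, k), (m', k')) := (loc_repr x, loc_repr y) in
  frac (s ^+ k' *: m + s ^+ k *: m') (k + k').
Definition loc_opp (x : loc) : loc := frac (- (loc_repr x).1) (loc_repr x).2.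
Definition loc_scale (a : A) (x : loc) : loc :=
  frac (a *: (loc_repr x).1) (loc_repr x).2.

Lemma loc_scaleE a m k : loc_scale a (frac m k) = frac (a *: m) k.
Proof.
have /fracP[l e] := loc_reprK (frac m k).
apply/fracP; exists l; rewrite !scalerA ![_ * a]mulrC -!scalerA.
by rewrite e.
Qed.

Lemma loc_oppE m k : loc_opp (frac m k) = frac (- m) k.
Proof.
have /fracP[l e] := loc_reprK (frac m k).
by apply/fracP; exists l; rewrite !scalerN e.
Qed.

Lemma loc_addE m m' k : loc_add (frac m k) (frac m' k) = frac (m + m') k.
Proof.
rewrite /loc_add.
have /fracP[l] := loc_reprK (frac m k).
have /fracP[l'] := loc_reprK (frac m' k).
case: (loc_repr (frac m k)) => u p; case: (loc_repr (frac m' k)) => u' p' /=.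
move=> e' e; apply/fracP; exists (l + l')%N.
rewrite !scalerDr !scalerA -!exprD; congr (_ + _).
  have -> : (l + l' + k + p' = (l' + p') + (l + k))%N by lia.
  rewrite exprD -scalerA e scalerA -exprD; congr (s ^+ _ *: _); lia.
have -> : (l + l' + k + p = (l + p) + (l' + k))%N by lia.
rewrite exprD -scalerA e' scalerA -exprD; congr (s ^+ _ *: _); lia.
Qed.

Let addA : associative loc_add.
Proof.
move=> x y z; have [k [m [m' [-> ->]]]] := frac_common x y.
elim/loc_ind: z => n l.
rewrite -(frac_expand l m) -(frac_expand l m') -(frac_expand k n).
by rewrite [(k + l)%N]addnC !loc_addE addrA.
Qed.

Let addC : commutative loc_add.
Proof.
move=> x y; have [k [m [m' [-> ->]]]] := frac_common x y.
by rewrite !loc_addE addrC.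
Qed.

Let frac0 k : frac 0 0 = frac 0 k.
Proof. by apply/fracP; exists 0%N; rewrite !scaler0. Qed.

Let add0 : left_id (frac 0 0) loc_add.
Proof. by elim/loc_ind=> m k; rewrite (frac0 k) loc_addE add0r. Qed.

Let addN : left_inverse (frac 0 0) loc_opp loc_add.
Proof. by elim/loc_ind=> m k; rewrite loc_oppE loc_addE addNr -frac0. Qed.

HB.instance Definition _ := GRing.isZmodule.Build loc addA addC add0 addN.

Let scaleA a b x : loc_scale a (loc_scale b x) = loc_scale (a * b) x.
Proof. by elim/loc_ind: x => m k; rewrite !loc_scaleE scalerA. Qed.

Let scale1 : left_id 1 loc_scale.
Proof. by elim/loc_ind=> m k; rewrite loc_scaleE scale1r. Qed.

Let scaleDr : right_distributive loc_scale +%R.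
Proof.
move=> a x y; have [k [m [m' [-> ->]]]] := frac_common x y.
by rewrite [frac m k + _]loc_addE !loc_scaleE [RHS]loc_addE scalerDr.
Qed.

Let scaleDl x : {morph loc_scale^~ x : a b / a + b}.
Proof.
by elim/loc_ind: x => m k a b; rewrite !loc_scaleE [RHS]loc_addE scalerDl.
Qed.

HB.instance Definition _ := GRing.Zmodule_isLmodule.Build A loc
  scaleA scale1 scaleDr scaleDl.

Lemma fracD m m' k : frac (m + m') k = frac m k + frac m' k.
Proof. by rewrite -loc_addE. Qed.

Lemma fracZ a m k : frac (a *: m) k = a *: frac m k.
Proof. by rewrite -loc_scaleE. Qed.

End Localization.

Section LocalizationMap.
Variables (A : comPzRingType) (M : lmodType A) (s t u : A).

(* When t = u * s this is the canonical map M_s -> M_t, because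
   m / s^k = u^k m / t^k; see [loc_mapE]. *)
Definition loc_map (x : loc M s) : loc M t :=
  frac t (u ^+ (loc_repr x).2 *: (loc_repr x).1) (loc_repr x).2.

Hypothesis tE : t = u * s.

Lemma loc_mapE m k : loc_map (frac s m k) = frac t (u ^+ k *: m) k.
Proof.
have /fracP[l e] := loc_reprK (frac s m k).
rewrite /loc_map; move: e; case: (loc_repr _) => m' k' /= e.
apply/fracP; exists l; rewrite tE !scalerA !exprMn.
have ee a b : u ^+ (l + a) * s ^+ (l + a) * u ^+ b =
    u ^+ (l + a + b) * s ^+ (l + a) by rewrite mulrAC -exprD.
by rewrite !ee -!scalerA e -addnA (addnC k) addnA.
Qed.

Lemma loc_map_linear : linear loc_map.
Proof.
move=> a x y; have [k [m [m' [-> ->]]]] := frac_common x y.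
rewrite -fracZ -fracD !loc_mapE -fracZ -fracD; congr (frac _ _ _).
by rewrite scalerDr !scalerA mulrC.
Qed.

End LocalizationMap.
Arguments loc_map {A M s t} u x.

Section CechComplex.
Variables (A : comPzRingType) (n : nat) (s : 'I_n -> A) (M : lmodType A).
Implicit Type S : {set 'I_n}.

(* All the terms of the Cech complex at once: the p-cochains are the families
   supported on the sets S with p elements. *)
Definition cochain : Type := forall S, loc M (\prod_(i in S) s i).
HB.instance Definition _ := gen_eqMixin cochain.
HB.instance Definition _ := gen_choiceMixin cochain.

Definition cochain_add (c d : cochain) : cochain := fun S => c S + d S.
Definition cochain_opp (c : cochain) : cochain := fun S => - c S.
Definition cochain_zero : cochain := fun S => 0.
Definition cochain_scale (a : A) (c : cochain) : cochain := fun S => a *: c S.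

Let addA : associative cochain_add.
Proof. by move=> b c d; apply: functional_extensionality_dep => S; exact: addrA. Qed.
Let addC : commutative cochain_add.
Proof. by move=> c d; apply: functional_extensionality_dep => S; exact: addrC. Qed.
Let add0 : left_id cochain_zero cochain_add.
Proof. by move=> c; apply: functional_extensionality_dep => S; exact: add0r. Qed.
Let addN : left_inverse cochain_zero cochain_opp cochain_add.
Proof. by move=> c; apply: functional_extensionality_dep => S; exact: addNr. Qed.

HB.instance Definition _ := GRing.isZmodule.Build cochain addA addC add0 addN.

Let scaleA a b c : cochain_scale a (cochain_scale b c) = cochain_scale (a * b) c.
Proof. by apply: functional_extensionality_dep => S; exact: scalerA. Qed.
Let scale1 : left_id 1 cochain_scale.
Proof. by move=> c; apply: functional_extensionality_dep => S; exact: scale1r. Qed.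
Let scaleDr : right_distributive cochain_scale +%R.
Proof. by move=> a c d; apply: functional_extensionality_dep => S; exact: scalerDr. Qed.
Let scaleDl c : {morph cochain_scale^~ c : a b / a + b}.
Proof. by move=> a b; apply: functional_extensionality_dep => S; exact: scalerDl. Qed.

HB.instance Definition _ := GRing.Zmodule_isLmodule.Build A cochain
  scaleA scale1 scaleDr scaleDl.

Definition cech_restr S (i : 'I_n) :
  loc M (\prod_(j in S :\ i) s j) -> loc M (\prod_(j in S) s j) :=
  loc_map (s i).

Definition cech_d (c : cochain) : cochain := fun S =>
  \sum_(i in S) (-1) ^+ #|[set j in S | (j < i)%N]| *: cech_restr (c (S :\ i)).

Lemma cech_prod S i : i \in S ->
  \prod_(j in S) s j = s i * \prod_(j in S :\ i) s j.
Proof. by move=> iS; rewrite (big_setD1 i). Qed.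

Lemma cech_d_linear : linear cech_d.
Proof.
move=> a c d; apply: functional_extensionality_dep => S.
rewrite /cech_d; change (\sum_(i in S) (-1) ^+ #|[set j in S | (j < i)%N]| *:
    cech_restr (a *: c (S :\ i) + d (S :\ i)) =
  a *: (\sum_(i in S) (-1) ^+ #|[set j in S | (j < i)%N]| *:
    cech_restr (c (S :\ i))) +
  \sum_(i in S) (-1) ^+ #|[set j in S | (j < i)%N]| *:
    cech_restr (d (S :\ i))).
rewrite scaler_sumr -big_split /=; apply: eq_bigr => i iS.
rewrite /cech_restr (loc_map_linear (cech_prod iS)) scalerDr !scalerA.
by rewrite [in LHS]mulrC.
Qed.

Definition in_degree (p : nat) (c : cochain) : Prop :=
  forall S, #|S| <> p -> c S = 0.

Definition cocycle_pred (p : nat) : {pred cochain} :=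
  fun c => `[< in_degree p c /\ cech_d c = 0 >].

Lemma cocycle_submod_closed p : submod_closed (cocycle_pred p).
Proof.
have d0 : cech_d 0 = 0.
  by have := cech_d_linear (-1) 0 0; rewrite scaler0 addr0 scaleN1r addNr.
split=> [|a c d /asboolP[hc dc] /asboolP[hd dd]]; apply/asboolP; split=> //.
  move=> S hS; change (a *: c S + d S = 0).
  by rewrite hc // hd // scaler0 addr0.
by rewrite cech_d_linear dc dd scaler0 addr0.
Qed.

HB.instance Definition _ p :=
  GRing.isSubmodClosed.Build A cochain (cocycle_pred p) (cocycle_submod_closed p).

Record cocycle (p : nat) :=
  Cocycle { cocycle_val :> cochain; _ : cocycle_val \in cocycle_pred p }.

HB.instance Definition _ p := [isSub for @cocycle_val p].
HB.instance Definition _ p := [Choice of cocycle p by <:].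
HB.instance Definition _ p := [SubChoice_isSubLmodule of cocycle p by <:].

Definition coboundary_pred (p : nat) : {pred cocycle p} :=
  match p with
  | 0 => fun z => z == 0
  | q.+1 => fun z => `[< exists2 b, in_degree q b & cocycle_val z = cech_d b >]
  end.

Lemma coboundary_submod_closed p : submod_closed (@coboundary_pred p).
Proof.
have d0 : cech_d 0 = 0.
  by have := cech_d_linear (-1) 0 0; rewrite scaler0 addr0 scaleN1r addNr.
case: p => [|q]; split=> /=.
- by rewrite /in_mem /= /coboundary_pred eqxx.
- by move=> a y z; rewrite /in_mem /= => /eqP-> /eqP->; rewrite scaler0 addr0.
- by apply/asboolP; exists 0.
- move=> a y z /asboolP[b hb yb] /asboolP[c hc zc]; apply/asboolP.
  exists (a *: b + c); last by rewrite cech_d_linear -yb -zc.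
  move=> S hS; change (a *: b S + c S = 0).
  by rewrite hb // hc // scaler0 addr0.
Qed.

HB.instance Definition _ p := GRing.isSubmodClosed.Build A (cocycle p)
  (@coboundary_pred p) (@coboundary_submod_closed p).

Definition cech_cohomology (p : nat) : lmodType A := quotmod (@coboundary_pred p).

End CechComplex.

(* A grading of M by bidegrees is given by its components [gr i j].  The
   elements of the sequence are understood to be of bidegree (0, 1), so that
   dividing by the k-th power of the product over S lowers the second degree
   by k #|S|. *)
Section BigradedCech.
Variables (A : comPzRingType) (n : nat) (s : 'I_n -> A) (M : lmodType A).
Variable gr : int -> int -> set M.

Definition cochain_gr (i j : int) : set (cochain s M) :=
  [set c | forall S : {set 'I_n}, exists k r,
    gr i (j + (k * #|S|)%:Z) r /\ c S = frac _ r k].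

Definition cech_cohomology_gr (p : nat) (i j : int) :
    set (cech_cohomology s M p) :=
  [set quotmod_pi (@coboundary_pred A n s M p) z
    | z in [set z : cocycle s M p | cochain_gr i j z]].

End BigradedCech.

Definition hom_poly (R : nzRingType) (m : nat) (d : int) (p : {mpoly R[m]}) :
  Prop := forall u, u \in msupp p -> (mdeg u)%:Z = d.

Definition graded_max_ideal (K : fieldType) (m : nat) : set {mpoly K[m]} :=
  ideal_gen (codom (fun i : 'I_m => 'X_i : {mpoly K[m]})).

Section Regularity.
Variables (K : fieldType) (m : nat).
Local Notation P0 := {mpoly K[m]}.

(* The graded module is the submodule of V which is the direct sum of the
   [N i]; it need not be all of V. *)
Variables (V : lmodType P0) (N : int -> set V).

(* F_p is free on [res_rank p] homogeneous generators, of degrees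
   [res_deg p]; its elements are row vectors, and the a-th row of
   [res_diff p] is the image of the a-th generator of F_(p+1) in F_p. *)
Record graded_free_resolution := GradedFreeResolution {
  res_rank : nat -> nat;
  res_deg : forall p, 'I_(res_rank p) -> int;
  res_aug : 'I_(res_rank 0) -> V;
  res_diff : forall p, 'M[P0]_(res_rank p.+1, res_rank p);
  res_aug_homog : forall a, N (res_deg a) (res_aug a);
  res_diff_homog : forall p a b,
    hom_poly (res_deg a - res_deg b) (res_diff p a b);
  res_aug_surj : forall i v, N i v ->
    exists c : 'rV[P0]_(res_rank 0), v = \sum_a c 0 a *: res_aug a;
  res_aug_exact : forall c : 'rV[P0]_(res_rank 0),
    \sum_a c 0 a *: res_aug a = 0 <-> exists b, c = b *m res_diff 0;
  res_diff_exact : forall p (c : 'rV[P0]_(res_rank p.+1)),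
    c *m res_diff p = 0 <-> exists b, c = b *m res_diff p.+1
}.

Definition minimal_resolution (F : graded_free_resolution) : Prop :=
  forall p a b, @graded_max_ideal K m (res_diff F p a b).

(* The supremum of the b - p over the generators of degree b of F_p.  A
   finitely generated graded module has exactly one minimal resolution F up to
   isomorphism, so that letting F vary does not change the set. *)
Definition regularity : \bar int :=
  supremum -oo%E [set r | exists2 F : graded_free_resolution,
    minimal_resolution F &
    exists p (a : 'I_(res_rank F p)), r = (res_deg a - p%:Z)%:E].

End Regularity.

Section Hypersurface.
Variables (K : fieldType) (m n : nat).
Local Notation P0 := {mpoly K[m]}.

(* P = P_0[y_1, ..., y_n], so that [f@_b] is the coefficient of y^b in P_0. *)
Local Notation P := {mpoly P0[n]}.
Implicit Type f : P.

Definition bihomog (i j : int) : set P :=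
  [set p | forall b, b \in msupp p -> (mdeg b)%:Z = j /\ hom_poly i p@_b].

Definition bihomogeneous f : Prop := exists a b, bihomog a b f.

Definition coef_ideal f : set P0 := ideal_gen [seq f@_b | b <- msupp f].

Definition principal_pred f : {pred P^o} := fun p => `[< exists g, p = g * f >].

Lemma principal_submod_closed f : submod_closed (principal_pred f).
Proof.
split=> [|a p q /asboolP[g ->] /asboolP[h ->]]; apply/asboolP.
  by exists 0; rewrite mul0r.
by exists (a * g + h); rewrite [in RHS]mulrDl -mulrA.
Qed.

HB.instance Definition _ f := GRing.isSubmodClosed.Build P P^o
  (principal_pred f) (principal_submod_closed f).

(* R is only needed as a P-module. *)
Definition hypersurface f : lmodType P := quotmod (principal_pred f).

Definition hypersurface_gr f (i j : int) : set (hypersurface f) :=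
  [set quotmod_pi (principal_pred f) p | p in bihomog i j].
Arguments hypersurface_gr f i j _ : clear implicits.

(* H^p_{P_+}(M), computed as the cohomology of the Cech complex on the
   generators y_1, ..., y_n of P_+, and regarded as a P_0-module. *)
Definition local_cohomology (M : lmodType P) (p : nat) : lmodType P0 :=
  restrict_scalars (@mpolyC n P0) (cech_cohomology (fun i : 'I_n => 'X_i) M p).

(* The graded P_0-module H^p_{P_+}(R)_j, by its components. *)
Definition hypersurface_cohomology_comp f (p : nat) (j : int) :
    int -> set (local_cohomology (hypersurface f) p) :=
  fun i => @cech_cohomology_gr P n (fun k : 'I_n => 'X_k) (hypersurface f)
    (hypersurface_gr f) p i j.

End Hypersurface.
Arguments hypersurface_gr {K m n} f i j _.
Arguments hypersurface_cohomology_comp {K m n} f p j i _.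

(* Main.v *)
From HB Require Import structures.
Require Import Defs.
From mathcomp Require Import all_boot all_order all_algebra.
From mathcomp Require Import zify.
From mathcomp Require Import boolp mpoly classical_sets constructive_ereal.

(** Write [P0 = K[x]], [P = P0[y]], and [d = - j - n].  The module
[H^n(R)_j] is the cokernel of multiplication by [f] on the inverse polynomials
in [y], generated over [P0] by the finitely many monomials [y^(-g-1)] with
[|g| = d], all placed in degree 0 of the grading of [P0].  If it vanishes in
degrees [>= k], its regularity is less than [k], so that it suffices to find
such a [k] that is linear in [d].

Dually, an inverse polynomial is a linear form on [P0[y]], on which [f] acts by
transposition.  So [a] in [P0] kills the cokernel as soon as [a] times each
coordinate form on the polynomials of degree [<= d] has the form [p |-> L(f p)]
for a linear form [L]; such [a] make up [transfer_ideal f d].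
The point is to prove that a power of the [x_i] whose exponent is linear in [d]
belongs to this ideal.

- The coefficients of [f^(d+1)] belong to it ([exp_coefs_transfer]).  Expanding
  [p] at a generic point [Y], write [f(Y+z) = f(Y) - h] with [h] in the ideal
  [(z)]: modulo [(z)^(d+1)], multiplication by [f(Y+z)] is inverted, up to the
  factor [f(Y)^(d+1)], by the partial sum of a geometric series.  A polynomial
  [p] of degree [<= d] is thus recovered linearly from [f p], up to the factor
  [f(Y)^(d+1)], whose coefficients in [Y] can be taken one at a time.
- If the coefficients of a power [g^e] lie in an ideal, then so do the powers
  of exponent [2^s e] of the [s] coefficients of [g] ([coef_exp_in]): the
  leading coefficient is nilpotent of exponent [e] modulo the ideal, so that
  removing the leading term from [g] doubles the exponent.  As [s] depends on
  [f] only, this keeps the bound linear in [d].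
- As [I(f)] contains a power of each [x_i], all homogeneous polynomials of
  degree [> C (d+1)] are in the ideal, where [C] depends on [f] only
  ([transfer_high_degree]).

For the bound on the regularity ([regularity_lt]), let [F] be a minimal
resolution of a module [N] that vanishes in degrees [>= k].  The group
[Tor_p(N, P0/(x_1, ..., x_l))] vanishes in the degrees [>= k + p]: this is clear
if [l = 0], and one passes from [l] to [l+1] because [x_(l+1)] is a nonzerodivisor
on [P0/(x_1, ..., x_l)] ([tor_vanishing]).  For [l = m] and [F] minimal this
[Tor] is [F_p/(x)F_p], which therefore has no generators in these degrees. *)

Set Implicit Arguments.
Unset Strict Implicit.
Unset Printing Implicit Defensive.

Import Order.TTheory GRing.Theory Num.Theory.
Local Open Scope ring_scope.

(** * Polynomials given by their coefficients, homogeneous components *)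

Section PolynomialOfCoefficients.
Variables (n : nat) (R : nzRingType).

Definition mpoly_of_coef (k : nat) (g : 'X_{1..n} -> R) : {mpoly R[n]} :=
  \sum_(u : 'X_{1..n < k}) g u *: 'X_[u].

Lemma mcoeff_sum (I : Type) (s : seq I) (P : pred I) (F : I -> {mpoly R[n]}) u :
  (\sum_(i <- s | P i) F i)@_u = \sum_(i <- s | P i) (F i)@_u.
Proof. exact: raddf_sum. Qed.

Lemma mcoeff_of_coef k g u :
  (mpoly_of_coef k g)@_u = if (mdeg u < k)%N then g u else 0.
Proof.
case: ifPn => [|ku]; first exact: mcoeff_mpoly.
rewrite mcoeff_sum big1 //= => v _; rewrite mcoeffZ mcoeffX.
by case: eqP => [vu|_]; [rewrite -vu bmdeg in ku|rewrite mulr0].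
Qed.

Lemma mcoeff_ge_msize (p : {mpoly R[n]}) u : (msize p <= mdeg u)%N -> p@_u = 0.
Proof. by move=> /msize_mdeg_ge/memN_msupp_eq0. Qed.

Lemma hom_polyP (d : int) (p : {mpoly R[n]}) :
  hom_poly d p <-> forall u, (mdeg u)%:Z <> d -> p@_u = 0.
Proof.
split=> [hp u ud|hp u].
  by apply/eqP; rewrite mcoeff_eq0; apply/negP => /hp.
by rewrite mcoeff_msupp => pu; apply/eqP; apply: contra_neqT pu => /eqP; apply: hp.
Qed.

Lemma hom_polyD (d : int) (p q : {mpoly R[n]}) :
  hom_poly d p -> hom_poly d q -> hom_poly d (p + q).
Proof.
move=> /hom_polyP hp /hom_polyP hq; apply/hom_polyP => u ud.
by rewrite mcoeffD hp // hq // addr0.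
Qed.

Lemma hom_polyN (d : int) (p : {mpoly R[n]}) : hom_poly d p -> hom_poly d (- p).
Proof.
by move=> /hom_polyP hp; apply/hom_polyP => u ud; rewrite mcoeffN hp // oppr0.
Qed.

Lemma hom_poly_sum (d : int) (I : Type) (s : seq I) (F : I -> {mpoly R[n]}) :
  (forall i, hom_poly d (F i)) -> hom_poly d (\sum_(i <- s) F i).
Proof.
move=> hF; apply: big_ind => // [|p q]; last exact: hom_polyD.
by apply/hom_polyP => u _; rewrite mcoeff0.
Qed.

Lemma hom_polyM (d e : int) (p q : {mpoly R[n]}) :
  hom_poly d p -> hom_poly e q -> hom_poly (d + e) (p * q).
Proof.
move=> /hom_polyP hp /hom_polyP hq; apply/hom_polyP => u ud.
rewrite mcoeffM big1 // => -[v w] /= /eqP uE.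
have [vd|/eqP/hp->] := eqVneq (mdeg v)%:Z d; last by rewrite mul0r.
have [wd|/eqP/hq->] := eqVneq (mdeg w)%:Z e; last by rewrite mulr0.
by case: ud; rewrite uE mdegD PoszD vd wd.
Qed.

Definition hom_comp (d : int) (p : {mpoly R[n]}) : {mpoly R[n]} :=
  mpoly_of_coef (msize p) (fun u => if (mdeg u)%:Z == d then p@_u else 0).

Lemma mcoeff_hom_comp d p u :
  (hom_comp d p)@_u = if (mdeg u)%:Z == d then p@_u else 0.
Proof.
rewrite mcoeff_of_coef; case: ltnP => // /mcoeff_ge_msize ->.
by rewrite if_same.
Qed.

Lemma hom_comp_hom d p : hom_poly d (hom_comp d p).
Proof. by apply/hom_polyP => u /eqP/negPf ud; rewrite mcoeff_hom_comp ud. Qed.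

Lemma hom_comp_id d p : hom_poly d p -> hom_comp d p = p.
Proof.
move=> /hom_polyP hp; apply/mpolyP => u; rewrite mcoeff_hom_comp.
by case: eqP => // /hp.
Qed.

Lemma hom_comp_sum d (I : Type) (s : seq I) (F : I -> {mpoly R[n]}) :
  hom_comp d (\sum_(i <- s) F i) = \sum_(i <- s) hom_comp d (F i).
Proof.
apply/mpolyP => u; rewrite mcoeff_hom_comp !mcoeff_sum.
case: ifPn => ud; last by rewrite big1 // => i _; rewrite mcoeff_hom_comp (negPf ud).
by apply: eq_bigr => i _; rewrite mcoeff_hom_comp ud.
Qed.

Lemma hom_compM d e p q :
  hom_poly e q -> hom_comp d (p * q) = hom_comp (d - e) p * q.
Proof.
move=> /hom_polyP hq; apply/mpolyP => u; rewrite mcoeff_hom_comp !mcoeffM.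
rewrite -mulrb -sumrMnl; apply: eq_bigr => -[[v ?] [w ?]] /= /eqP uE.
rewrite mcoeff_hom_comp.
have [we|/eqP/hq->] := eqVneq (mdeg w)%:Z e; last by rewrite !mulr0 mul0rn.
rewrite mulrb uE mdegD PoszD we.
have -> : ((mdeg v)%:Z == d - e) = ((mdeg v)%:Z + e == d) by lia.
by case: ifP => //; rewrite mul0r.
Qed.

End PolynomialOfCoefficients.

(** * The ideals generated by the first variables *)

Section MonomialIdeals.
Variables (m : nat) (K : idomainType).
Local Notation P0 := {mpoly K[m]}.
Implicit Types (l : nat) (p q : P0).

(** The ideal [(x_0, ..., x_(l-1))], described by its monomials: this makes
both the regularity of [x_l] modulo the ideal and the division by [x_l]
immediate. *)
Definition first_vars_ideal l p :=
  forall u : 'X_{1..m}, (forall i : 'I_m, (i < l)%N -> u i = 0%N) -> p@_u = 0.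

Lemma first_vars_ideal0 p : first_vars_ideal 0 p -> p = 0.
Proof. by move=> hp; apply/mpolyP => u; rewrite hp // mcoeff0. Qed.

Lemma first_vars_idealD l p q :
  first_vars_ideal l p -> first_vars_ideal l q -> first_vars_ideal l (p + q).
Proof. by move=> hp hq u hu; rewrite mcoeffD hp // hq // addr0. Qed.

Lemma first_vars_idealMr l p q :
  first_vars_ideal l p -> first_vars_ideal l (p * q).
Proof.
move=> hp u hu; rewrite mcoeffM big1 // => -[[v ?] [w ?]] /= /eqP uE.
rewrite hp ?mul0r // => i il; apply/eqP.
by have := hu i il; rewrite uE mnmDE => /eqP; rewrite addn_eq0 => /andP[].
Qed.

Lemma first_vars_idealMl l p q :
  first_vars_ideal l q -> first_vars_ideal l (p * q).
Proof. by rewrite mulrC; exact: first_vars_idealMr. Qed.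

Lemma first_vars_ideal_sum l (I : Type) (s : seq I) (F : I -> P0) :
  (forall i, first_vars_ideal l (F i)) -> first_vars_ideal l (\sum_(i <- s) F i).
Proof.
move=> hF; apply: (big_ind (first_vars_ideal l)) => // [u _|p q].
  by rewrite mcoeff0.
exact: first_vars_idealD.
Qed.

Lemma first_vars_ideal_le l l' p :
  (l <= l')%N -> first_vars_ideal l p -> first_vars_ideal l' p.
Proof. by move=> ll' hp u hu; apply: hp => i il; apply: hu; exact: leq_trans ll'. Qed.

Lemma first_vars_ideal_var l (i : 'I_m) : (i < l)%N -> first_vars_ideal l 'X_i.
Proof.
move=> il u /(_ i il) ui; rewrite mcoeffX; case: eqP => // iu.
by rewrite -iu mnm1E eqxx in ui.
Qed.

Lemma first_vars_ideal_regular (i : 'I_m) p :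
  first_vars_ideal i (p * 'X_i) -> first_vars_ideal i p.
Proof.
move=> hp u hu; rewrite -(mcoeffMX p U_(i)%MM u) hp // => j ji.
by rewrite mnmDE hu // mnm1E; case: eqP ji => // ->; rewrite ltnn.
Qed.

(** The quotient by [x_i] is read off coefficientwise, so that it inherits
homogeneity from [p]; a mere membership in the sum of ideals would not
give this. *)
Lemma first_vars_ideal_split (i : 'I_m) (d : int) p :
  hom_poly d p -> first_vars_ideal i.+1 p ->
  exists2 z, hom_poly (d - 1) z & first_vars_ideal i (p - z * 'X_i).
Proof.
move=> /hom_polyP hp ip; exists (mpoly_of_coef (msize p) (fun u =>
  p@_(U_(i) + u)%MM)).
  apply/hom_polyP => u ud; rewrite mcoeff_of_coef; case: ifP => // _.
  by rewrite hp // mdegD mdeg1 PoszD => e; apply: ud; rewrite -e addrAC subrr add0r.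
move=> u hu; rewrite mcoeffB; have [ui|ui] := eqVneq (u i) 0%N.
  rewrite ip ?sub0r; last first.
    move=> j; rewrite ltnS leq_eqVlt => /orP[/eqP/val_inj-> //|]; exact: hu.
  rewrite mcoeffM big1 ?oppr0 // => -[[v ?] [w ?]] /= /eqP uE.
  rewrite mcoeffX; case: eqP => [iw|_]; last by rewrite mulr0.
  by move: ui; rewrite uE mnmDE -iw mnm1E eqxx addn1.
have uE : u = (U_(i) + (u - U_(i)))%MM by rewrite addmC submK // lep1mP.
rewrite [in X in _ - X]uE mcoeffMX mcoeff_of_coef -uE.
case: ltnP => [_|le]; first by rewrite subrr.
rewrite subr0 mcoeff_ge_msize //; apply: leq_trans le _.
by rewrite {2}uE mdegD leq_addl.
Qed.

Lemma first_vars_ideal_max p :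
  ideal_gen (codom (fun i : 'I_m => 'X_i : P0)) p -> first_vars_ideal m p.
Proof.
move=> [c ->]; apply: first_vars_ideal_sum => i; apply: first_vars_idealMl.
have /codomP[k ->] := mem_nth 0 (ltn_ord i).
exact: first_vars_ideal_var.
Qed.

Lemma first_vars_ideal_proper : ~ first_vars_ideal m 1.
Proof.
move=> h; have /eqP := h 0%MM (fun i _ => mnm0E i).
by rewrite mcoeff1 eqxx oner_eq0.
Qed.

End MonomialIdeals.

(** * Regularity of modules that vanish in high degrees *)

Section RegularityBound.
Variables (K : fieldType) (m : nat).
Local Notation P0 := {mpoly K[m]}.
Variables (V : lmodType P0) (N : int -> set V) (k : int).
Hypothesis mulN0 : forall (i e : int) (c : P0) v,
  N i v -> hom_poly e c -> k <= i + e -> c *: v = 0.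
Variable F : graded_free_resolution N.

Definition row_in_first_vars l r (y : 'rV[P0]_r) :=
  forall b, first_vars_ideal l (y 0 b).

Definition row_hom (p : nat) (D : int) (y : 'rV[P0]_(res_rank F p)) :=
  forall b, hom_poly (D - res_deg b) (y 0 b).

(** This says that [y] is a cycle in [F_p / (x_0, ..., x_(l-1)) F_p].  There is
no condition for [p = 0]: the complex that computes [Tor] does not contain the
augmentation. *)
Definition boundary_in_first_vars l (p : nat) : 'rV[P0]_(res_rank F p) -> Prop :=
  match p with
  | 0 => fun _ => True
  | q.+1 => fun y => row_in_first_vars l (y *m res_diff F q)
  end.

Lemma row_in_first_varsD l r (y z : 'rV[P0]_r) :
  row_in_first_vars l y -> row_in_first_vars l z -> row_in_first_vars l (y + z).
Proof. by move=> hy hz b; rewrite mxE; apply: first_vars_idealD. Qed.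

Lemma row_in_first_varsM l r s (y : 'rV[P0]_r) (M : 'M_(r, s)) :
  row_in_first_vars l y -> row_in_first_vars l (y *m M).
Proof.
move=> hy b; rewrite mxE; apply: first_vars_ideal_sum => a.
exact: first_vars_idealMr.
Qed.

Lemma row_in_first_varsZ l r c (y : 'rV[P0]_r) :
  row_in_first_vars l y -> row_in_first_vars l (c *: y).
Proof. by move=> hy b; rewrite mxE; apply: first_vars_idealMl. Qed.

Lemma row_homM p D (y : 'rV[P0]_(res_rank F p.+1)) :
  row_hom D y -> row_hom D (y *m res_diff F p).
Proof.
move=> hy b; rewrite mxE; apply: hom_poly_sum => a.
have := hom_polyM (hy a) (@res_diff_homog _ _ _ _ F p a b).
by rewrite addrA subrK.
Qed.

(** Exactness of the resolution provides preimages without control of the degree.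
As the differential is homogeneous, the component of the right degree of a
preimage is a preimage too. *)
Lemma row_hom_image p D (y : 'rV[P0]_(res_rank F p)) b :
  row_hom D y -> y = b *m res_diff F p ->
  exists2 v, row_hom D v & y = v *m res_diff F p.
Proof.
move=> hy yE; exists (\row_a hom_comp (D - res_deg a) (b 0 a)).
  by move=> a; rewrite mxE; exact: hom_comp_hom.
apply/rowP => c; rewrite -(hom_comp_id (hy c)) yE !mxE hom_comp_sum.
apply: eq_bigr => a _; rewrite mxE (hom_compM _ _ (@res_diff_homog _ _ _ _ F p a c)).
by congr (hom_comp _ _ * _); rewrite opprB addrA subrK.
Qed.

Lemma row_split p (i : 'I_m) D (y : 'rV[P0]_(res_rank F p)) :
  row_hom D y -> row_in_first_vars i.+1 y ->
  exists2 z, row_hom (D - 1) z & row_in_first_vars i (y - 'X_i *: z).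
Proof.
move=> hy iy.
have /choice[z zP] b : exists z, hom_poly (D - 1 - res_deg b) z /\
    first_vars_ideal i (y 0 b - z * 'X_i).
  have [z hz iz] := first_vars_ideal_split (hy b) (iy b).
  by exists z; split=> //; rewrite addrAC.
exists (\row_b z b) => b; rewrite !mxE; first by case: (zP b).
by rewrite mulrC; case: (zP b).
Qed.

(** A homogeneous cycle [y] of [F_p / (x_0, ..., x_(l-1)) F_p] of degree [D >= k + p]
is a boundary: [Tor_p(N, P0/(x_0, ..., x_(l-1)))_D = 0].  The induction follows the
long exact sequence of [Tor] for multiplication by [x_l] on
[P0/(x_0, ..., x_(l-1))], which places the [Tor] for [l+1] between
[Tor_p(N, P0/(x_0, ..., x_(l-1)))_D] and [Tor_(p-1)(N, P0/(x_0, ..., x_(l-1)))_(D-1)].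
Writing [d y = w + x_l z], regularity of [x_l] makes [z] a cycle modulo the
first [l] variables, hence a boundary [d v] there, and [y - x_l v] is a cycle
modulo the first [l] variables. *)
Lemma tor_vanishing l p D (y : 'rV[P0]_(res_rank F p)) : (l <= m)%N ->
  k + p%:Z <= D -> row_hom D y -> boundary_in_first_vars l y ->
  exists2 v, row_hom D v & row_in_first_vars l (y - v *m res_diff F p).
Proof.
elim: l p D y => [|l IHl] p D y lm Dp hy dy.
  suff [b yE] : exists b, y = b *m res_diff F p.
    have [v hv ->] := row_hom_image hy yE; exists v => // b'.
    by rewrite subrr mxE => u _; rewrite mcoeff0.
  case: p => [|p] in Dp y hy dy *.
    (* Each term of the augmentation of [y] lies in [N_D], which is 0. *)
    apply/res_aug_exact; apply: big1 => a _.
    apply: mulN0 (@res_aug_homog _ _ _ _ F a) (hy a) _; rewrite addrC subrK.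
    by rewrite addr0 in Dp.
  apply/res_diff_exact/rowP => b; rewrite [RHS]mxE.
  exact/first_vars_ideal0/dy.
case: p => [|p] in Dp y hy dy *.
  have [v hv vy] := IHl 0 D y (ltnW lm) Dp hy I.
  by exists v => // b; apply: first_vars_ideal_le (vy b).
pose i := Ordinal lm.
have [z hz zy] := @row_split p i _ _ (row_homM hy) dy.
have dz : boundary_in_first_vars l z.
  case: p => [|p] // in Dp y hy dy z hz zy *.
  move=> b; apply: (@first_vars_ideal_regular _ _ i).
  have := row_in_first_varsM (res_diff F p) zy b.
  have -> : (y *m res_diff F p.+1 - 'X_i *: z) *m res_diff F p =
      - ('X_i *: (z *m res_diff F p)).
    rewrite mulmxBl -scalemxAl.
    have -> : y *m res_diff F p.+1 *m res_diff F p = 0.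
      by apply/res_diff_exact; exists y.
    by rewrite sub0r.
  rewrite !mxE mulrC => h; rewrite -[X in first_vars_ideal _ X]opprK -mulrN1.
  exact: first_vars_idealMr.
have Dz : k + p%:Z <= D - 1 by lia.
have [v hv vz] := IHl p _ z (ltnW lm) Dz hz dz.
have hxv : row_hom D ('X_i *: v).
  move=> b; rewrite mxE mulrC.
  have hx : hom_poly 1 ('X_i : P0).
    by move=> u; rewrite msuppX inE => /eqP->; rewrite mdeg1.
  have := hom_polyM (hv b) hx.
  by rewrite addrAC subrK.
have hyv : row_hom D (y - 'X_i *: v).
  move=> b; rewrite mxE; apply: hom_polyD (hy b) _.
  by rewrite mxE; apply: hom_polyN; exact: hxv.
have dyv : boundary_in_first_vars l (y - 'X_i *: v).
  rewrite /= mulmxBl -scalemxAl.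
  have -> : y *m res_diff F p - 'X_i *: (v *m res_diff F p) =
    (y *m res_diff F p - 'X_i *: z) + 'X_i *: (z - v *m res_diff F p).
    by rewrite scalerBr addrA subrK.
  exact/row_in_first_varsD/row_in_first_varsZ.
have [w hw wy] := IHl p.+1 D _ (ltnW lm) Dp hyv dyv.
exists w => //; rewrite -[y](subrK ('X_i *: v)) -addrA [_ *: _ - _]addrC addrA.
apply: row_in_first_varsD => b; first exact: first_vars_ideal_le (wy b).
by rewrite mxE; apply: first_vars_idealMr; exact: (@first_vars_ideal_var _ _ _ i).
Qed.

(** In a minimal resolution a generator of [F_p] is a cycle modulo all the
variables, and it is not a boundary modulo them. *)
Lemma generator_degree_lt p (a : 'I_(res_rank F p)) :
  minimal_resolution F -> res_deg a - p%:Z < k.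
Proof.
move=> minF; rewrite ltNge; apply/negP => ka.
have diff_in q (y : 'rV[P0]_(res_rank F q.+1)) :
    row_in_first_vars m (y *m res_diff F q).
  move=> b; rewrite mxE; apply: first_vars_ideal_sum => c.
  exact/first_vars_idealMl/first_vars_ideal_max/minF.
have Dp : k + p%:Z <= res_deg a by rewrite -lerBrDr.
have hy : row_hom (res_deg a) (delta_mx 0 a : 'rV[P0]_(res_rank F p)).
  move=> b; rewrite mxE eqxx; apply/hom_polyP => u.
  case: eqVneq => [->|_] /=; last by rewrite mcoeff0.
  by rewrite subrr mcoeff1 -mdeg_eq0; case: eqP => // -> [].
have dy : boundary_in_first_vars m (delta_mx 0 a : 'rV[P0]_(res_rank F p)).
  by case: p => //= p in a ka Dp hy *.
have [v _ /(_ a) va] := tor_vanishing (leqnn m) Dp hy dy.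
apply: (@first_vars_ideal_proper m K).
have := first_vars_idealD va (diff_in _ v a).
by rewrite !mxE !eqxx subrK.
Qed.

End RegularityBound.

(** The hypothesis combines that [N] is a graded module with [N_i = 0] for
[i >= k]; this is the form in which the vanishing is used. *)
Lemma regularity_lt (K : fieldType) (m : nat) (V : lmodType {mpoly K[m]})
    (N : int -> set V) (k : int) :
  (forall (i e : int) (c : {mpoly K[m]}) v,
    N i v -> hom_poly e c -> k <= i + e -> c *: v = 0) ->
  (regularity N <= (k - 1)%:E)%E.
Proof.
move=> mulN0; rewrite /regularity /supremum; case: ifP => _; first exact: leNye.
case: xgetP => [s _ [_ sP]|_]; last exact: leNye.
apply: sP => _ [F minF [p [a ->]]]; rewrite lee_fin lerBrDr lezD1.
exact: generator_degree_lt.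
Qed.
(** * Powers of elements modulo an ideal *)

Section Ideals.
Variables (A : comNzRingType) (J : set A).

Definition is_ideal : Prop :=
  [/\ J 0, forall a b, J a -> J b -> J (a + b) & forall c a, J a -> J (c * a)].

Hypothesis idealJ : is_ideal.

Lemma ideal_sum (I : Type) (s : seq I) (P : pred I) (F : I -> A) :
  (forall i, P i -> J (F i)) -> J (\sum_(i <- s | P i) F i).
Proof. by case: (idealJ) => J0 JD _; exact: big_ind. Qed.

Lemma ideal_exp_le a e e' : (e <= e')%N -> J (a ^+ e) -> J (a ^+ e').
Proof. by case: (idealJ) => _ _ JM ee' h; rewrite -(subnK ee') exprD; exact: JM. Qed.

Lemma ideal_expD a b e e' :
  J (a ^+ e) -> J (b ^+ e') -> J ((a + b) ^+ (e + e')).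
Proof.
case: (idealJ) => J0 JD JM ha hb; rewrite exprDn; apply: ideal_sum => i _.
rewrite -mulr_natl; apply: (JM).
have [ei|ei] := leqP e' i; first exact/JM/(ideal_exp_le ei).
by rewrite mulrC; apply/JM/(ideal_exp_le _ ha); lia.
Qed.

Lemma ideal_exp_sum (N E : nat) (c x : 'I_N -> A) :
  (forall i, J (x i ^+ E)) -> J ((\sum_i c i * x i) ^+ (N * E).+1).
Proof.
case: (idealJ) => J0 JD JM; elim: N c x => [|N IHN] c x xE.
  by rewrite big_ord0 expr0n.
rewrite big_ord_recr /= mulSn addnC -addSn; apply: ideal_expD.
  exact: (IHN (fun i => c (widen_ord (leqnSn N) i)) (fun i => x (widen_ord _ i))).
by rewrite exprMn; exact: JM.
Qed.

End Ideals.

Section ContentOfPowers.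
Variables (A : comNzRingType) (n : nat) (J : set A).
Hypothesis idealJ : is_ideal J.
Local Notation P := {mpoly A[n]}.

Definition coefs_in : set P := [set p | forall u, J p@_u].

Lemma coefs_in_ideal : is_ideal coefs_in.
Proof.
case: (idealJ) => J0 JD JM; split=> [u|p q hp hq u|c p hp u].
- by rewrite mcoeff0.
- by rewrite mcoeffD; exact: JD.
- by rewrite mcoeffM; apply: ideal_sum => // i _; exact: JM.
Qed.

(** Modulo [J] the leading coefficient [c] of [g] satisfies [c^e = 0], since [c^e]
is a coefficient of [g^e].  Hence [(g - c Y^v)^(2e) = 0], and the difference
has one term less than [g]. *)
Lemma coef_exp_in (g : P) e : (0 < e)%N -> coefs_in (g ^+ e) ->
  forall u, J (g@_u ^+ (2 ^ size (msupp g) * e)).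
Proof.
case: (idealJ) => J0 JD JM.
move sE : (size (msupp g)) => s; elim: s => [|s IHs] in g sE e * => e0 ge u.
  have -> : g = 0 by apply/eqP; rewrite -msupp_eq0 -size_eq0 sE.
  by rewrite mcoeff0 mul1n expr0n eqn0Ngt e0.
have g0 : g != 0 by rewrite -msupp_eq0 -size_eq0 sE.
set c := g@_(mlead g); have ce : J (c ^+ e) by rewrite -mleadcX; exact: ge.
pose g' := g - c *: 'X_[mlead g].
have g'e : coefs_in (g' ^+ (e + e)).
  apply: ideal_expD coefs_in_ideal _ _ _ _ ge _.
  rewrite -mul_mpolyC -mulrN exprMn -rmorphXn /= mulrC.
  case: coefs_in_ideal => _ _; apply => v.
  by rewrite mcoeffC mulrC; exact: JM.
have g's : size (msupp g') = s.
  by rewrite (perm_size (msupp_rem _ _)) size_rem ?mlead_supp // sE.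
have ee0 : (0 < e + e)%N by rewrite addn_gt0 e0.
have := IHs g' g's (e + e)%N ee0 g'e u.
rewrite mcoeffB mcoeffZ mcoeffX; case: eqP => [<- _|_]; last first.
  by rewrite mulr0 subr0 addnn -mul2n mulnA -expnSr.
apply: (ideal_exp_le idealJ) ce; apply: leq_pmull.
by rewrite expn_gt0.
Qed.

End ContentOfPowers.

(** * Expansion at a generic point *)

Section Taylor.
Variables (A : comNzRingType) (n : nat).
Local Notation P := {mpoly A[n]}.
Local Notation W := {mpoly P[n]}.

(** The expansion [p(Y + z)]: the indeterminates of the coefficient ring [P] of
[W] are the [Y_i], and those of [W] itself are the [z_i]. *)
Definition taylor : P -> W :=
  mmap (@mpolyC n P \o @mpolyC n A) (fun i => ('X_i)%:MP + 'X_i).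
HB.instance Definition _ := GRing.RMorphism.on taylor.

(** The substitution [z = y - Y], where the [y_i] are again the indeterminates
of [W]; it undoes the translation in [taylor]. *)
Definition recenter : W -> W := mmap (@mpolyC n P) (fun i => 'X_i - ('X_i)%:MP).
HB.instance Definition _ := GRing.RMorphism.on recenter.

Lemma taylorX (u : 'X_{1..n}) :
  taylor 'X_[u] = \prod_i (('X_i)%:MP + 'X_i) ^+ u i.
Proof. by rewrite /taylor mmapX. Qed.

Lemma taylorZ c p : taylor (c *: p) = c%:MP%:MP * taylor p.
Proof. by rewrite /taylor mmapZ. Qed.

Lemma taylor_const p : (taylor p)@_0%MM = p.
Proof.
rewrite [in RHS](mpolyE p) /taylor /mmap mcoeff_sum; apply: eq_bigr => u _.
rewrite rmorphM /= mpolyCK mul_mpolyC /mmap1 rmorph_prod /= mpolyXE_id.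
congr (_ *: _); apply: eq_bigr => i _.
rewrite rmorphXn /= mcoeffD mpolyCK mcoeffX.
by rewrite mnm1_eq0 addr0.
Qed.

Lemma recenter_taylorX u : recenter (taylor 'X_[u]) = 'X_[u].
Proof.
rewrite taylorX rmorph_prod [RHS]mpolyXE_id; apply: eq_bigr => i _.
rewrite rmorphXn rmorphD /=; congr (_ ^+ _).
by rewrite /recenter mmapC mmapX mmap1U addrC subrK.
Qed.

End Taylor.

Lemma mcoeff_exp_low (A : comNzRingType) (n k : nat) (p q : {mpoly A[n]}) u :
  p@_0%MM = 0 -> (mdeg u < k)%N -> (p ^+ k * q)@_u = 0.
Proof.
move=> p0; elim: k u => // k IHk u uk.
rewrite exprS -mulrA mcoeffM big1 // => -[[v ?] [w ?]] /= /eqP uE.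
have [v0|v0] := eqVneq v 0%MM; first by rewrite v0 p0 mul0r.
rewrite IHk ?mulr0 //; move: uk v0; rewrite uE mdegD -mdeg_eq0.
by case: (mdeg v) => // d; rewrite addSn ltnS => /(leq_ltn_trans (leq_addl _ _)).
Qed.

Section DegreeBound.
Variables (A : comNzRingType) (n : nat).
Implicit Types p q : {mpoly A[n]}.

Definition deg_le k p := forall u, (k < mdeg u)%N -> p@_u = 0.

Lemma deg_leM k l p q : deg_le k p -> deg_le l q -> deg_le (k + l) (p * q).
Proof.
move=> pk ql u klu; rewrite mcoeffM big1 // => -[[v ?] [w ?]] /= /eqP uE.
have [vk|kv] := leqP (mdeg v) k; last by rewrite pk // mul0r.
rewrite ql ?mulr0 //; move: klu; rewrite uE mdegD; lia.
Qed.

Lemma deg_le_exp k e p : deg_le k p -> deg_le (k * e) (p ^+ e).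
Proof.
move=> pk; elim: e => [|e IHe]; last by rewrite exprS mulnS; exact: deg_leM.
move=> u; rewrite muln0 => u0; rewrite mcoeff1 -mdeg_eq0.
by rewrite -(prednK u0).
Qed.

Lemma deg_le_prod (I : finType) (k : I -> nat) (F : I -> {mpoly A[n]}) :
  (forall i, deg_le (k i) (F i)) -> deg_le (\sum_i k i) (\prod_i F i).
Proof.
move=> kF; apply: (big_rec2 (fun l p => deg_le l p)) => [u u0|i l p _ pl].
  by rewrite mcoeff1 -mdeg_eq0 -(prednK u0).
exact: deg_leM.
Qed.

Lemma msize_deg_le k p : deg_le k p -> (msize p <= k.+1)%N.
Proof.
move=> pk; rewrite msizeE; apply/bigmax_leqP_seq => u + _.
rewrite mcoeff_msupp ltnS leqNgt => /eqP pu; apply/negP => /pk; exact: pu.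
Qed.

End DegreeBound.

(** * The ideal of elements that kill the cokernel *)

Section Transfer.
Variables (A : comNzRingType) (n : nat) (f : {mpoly A[n]}) (d : nat).
Local Notation P := {mpoly A[n]}.
Local Notation W := {mpoly P[n]}.

(** The function [u] is the list of the values on the monomials of a linear form
[L], and the sum is [L (f y^e)].  So [a] belongs to the ideal if, for each
[g], [a] times the coefficient form at [y^g], restricted to the polynomials
of degree [<= d], is [p |-> L (f p)] for some [L]. *)
Definition transfer_ideal : set A := [set a | forall g, (mdeg g <= d)%N ->
  exists u : 'X_{1..n} -> A, forall e, (mdeg e <= d)%N ->
    \sum_(b <- msupp f) f@_b * u (b + e)%MM = a *+ (g == e)].

Lemma transfer_ideal_ideal : is_ideal transfer_ideal.
Proof.
split=> [g gd|a a' ha ha' g gd|c a ha g gd].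
- by exists (fun _ => 0) => e _; rewrite mul0rn big1 // => b _; rewrite mulr0.
- have [u hu] := ha g gd; have [u' hu'] := ha' g gd.
  exists (fun e => u e + u' e) => e ed; rewrite mulrnDl -hu // -hu' //.
  by rewrite -big_split; apply: eq_bigr => b _; rewrite mulrDr.
have [u hu] := ha g gd; exists (fun e => c * u e) => e ed.
rewrite -mulrnAr -hu // big_distrr; apply: eq_bigr => b _ /=.
by rewrite mulrCA.
Qed.

Let h : W := f%:MP - taylor f.
Let Q : W := \sum_(i < d.+1) f%:MP ^+ (d - i) * h ^+ i.

(** The factor [Q] inverts [f(Y+z) = f(Y) - h] up to the power [f(Y)^(d+1)] and a
multiple of [h^(d+1)]. *)
Let mulQ_taylor : Q * taylor f = (f ^+ d.+1)%:MP - h ^+ d.+1.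
Proof.
rewrite rmorphXn subrXX mulrC; congr (_ * _).
  by rewrite /h opprB addrC subrK.
Qed.

(** The coefficient at [y^g] of [Q p(Y+z)], truncated in degrees [> d] of [z] and
then written in terms of [y = Y + z]. *)
Let functional (g : 'X_{1..n}) (p : P) : P :=
  \sum_(v : 'X_{1..n < d.+1}) (Q * taylor p)@_v * (recenter 'X_[v])@_g.

(** The truncation kills the multiples of [h^(d+1)] as [h] has no constant
term in [z], and it preserves [y^e = (Y+z)^e] as this has degree [<= d]
in [z]. *)
Let functional_fX g e : (mdeg e <= d)%N ->
  functional g (f * 'X_[e]) = f ^+ d.+1 *+ (g == e).
Proof.
move=> ed; have te : (msize (taylor ('X_[e] : P)) <= d.+1)%N.
  apply: leq_trans (_ : (mdeg e).+1 <= d.+1)%N => //.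
  apply: msize_deg_le; rewrite taylorX mdegE; apply: deg_le_prod => i.
  rewrite -[X in deg_le X]mul1n; apply: deg_le_exp => u u1.
  rewrite mcoeffD mcoeffC mcoeffX.
  case: eqP => [u0|_]; first by rewrite u0 mdeg0 in u1.
  by case: eqP => [ui|_]; [rewrite -ui mdeg1 in u1|rewrite mulr0 addr0].
rewrite eq_sym -mulr_natr -[(e == g)%:R]mcoeffX -[in RHS]recenter_taylorX.
rewrite [in RHS](mpolywE te) rmorph_sum mcoeff_sum big_distrr.
apply: eq_bigr => v _ /=; rewrite rmorphM mulrA mulQ_taylor mulrBl mcoeffB.
have h0 : h@_0%MM = 0 by rewrite /h mcoeffB mpolyCK taylor_const subrr.
rewrite (mcoeff_exp_low _ h0 (bmdeg v)) subr0.
rewrite mcoeffCM -mulrA; congr (_ * _).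
by rewrite -mul_mpolyC rmorphM /= /recenter mmapC mcoeffCM.
Qed.

(** The coefficient at [Y^w] of [functional g] is linear over [A], and on
[f y^e] it is the coefficient of [f^(d+1)], or 0. *)
Lemma exp_coefs_transfer : coefs_in transfer_ideal (f ^+ d.+1).
Proof.
move=> w g gd; exists (fun e => (functional g 'X_[e])@_w) => e ed.
rewrite -mcoeffMn -functional_fX // {3}(mpolyE f) big_distrl /=.
rewrite /functional rmorph_sum big_distrr /=.
under [in RHS]eq_bigr => v _ do rewrite mcoeff_sum big_distrl /=.
rewrite exchange_big mcoeff_sum; apply: eq_bigr => b _ /=.
rewrite -mcoeffCM big_distrr /=; congr (_@_w); apply: eq_bigr => v _.
rewrite -scalerAl -mpolyXD taylorZ (mulrCA Q) mcoeffCM.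
by rewrite mulrA.
Qed.

End Transfer.

Section HighDegree.
Variables (K : fieldType) (m n : nat) (f : {mpoly {mpoly K[m]}[n]}).
Local Notation P0 := {mpoly K[m]}.

(** A monomial of degree [> m T] is divisible by the [T]-th power of a
variable. *)
Lemma ideal_high_degree (J : set P0) (T : nat) (e : int) (p : P0) :
  is_ideal J -> (forall i : 'I_m, J ('X_i ^+ T)) ->
  hom_poly e p -> (m * T)%:Z < e -> J p.
Proof.
move=> idealJ JX hp Te; rewrite (mpolyE p) big_seq; apply: ideal_sum => // u pu.
have [i iT] : exists i : 'I_m, (T <= u i)%N.
  apply/existsP; apply: contraPT (hp u pu) => /existsPn uT.
  have : (mdeg u <= m * T)%N.
    rewrite mdegE -[X in (_ <= X * _)%N]card_ord -sum_nat_const.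
    by apply: leq_sum => i _; rewrite ltnW // ltnNge uT.
  by move=> um ue; lia.
have -> : 'X_[u] = 'X_[u - U_(i) *+ T] * 'X_i ^+ T :> P0.
  rewrite mpolyXn -mpolyXD submK //; apply/mnm_lepP => k.
  by rewrite mulmnE mnm1E; case: eqP => // <-; rewrite mul1n.
by rewrite scalerAl; case: idealJ => _ _; apply.
Qed.

(** With [s] the number of terms of [f], the coefficients of [f] have their powers
of exponent [2^s (d+1)] in the ideal, hence any element of [coef_ideal f] has
its power of exponent [s 2^s (d+1) + 1] there. *)
Lemma transfer_high_degree :
  (forall i : 'I_m, exists k, coef_ideal f ('X_i ^+ k)) ->
  exists C : nat, forall d (e : int) (p : P0),
    hom_poly e p -> (C * d.+1)%:Z < e -> transfer_ideal f d p.
Proof.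
move=> /choice[k kP]; pose t := \max_i k i; pose s := size (msupp f).
exists (m * (t * (s * 2 ^ s).+1))%N => d e p hp Ce.
have idealJ := transfer_ideal_ideal f d.
apply: (ideal_high_degree (T := t * (s * (2 ^ s * d.+1)).+1) idealJ _ hp); last first.
  apply: le_lt_trans Ce; rewrite lez_nat -!mulnA leq_mul2l.
  rewrite leq_mul2l mulSn mulnA; apply/orP; right; apply/orP; right.
  by rewrite addnC -addn1 leq_add2l.
move=> i; have [c kE] := kP i.
have SJ (j : 'I_(size [seq f@_b | b <- msupp f])) :
    transfer_ideal f d ([seq f@_b | b <- msupp f]`_j ^+ (2 ^ s * d.+1)).
  have /mapP[b _ ->] := mem_nth 0 (ltn_ord j).
  exact: (coef_exp_in idealJ (ltn0Sn d) (exp_coefs_transfer (d:=d) f) b).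
have := ideal_exp_sum idealJ c SJ; rewrite -kE -exprM size_map.
apply: ideal_exp_le => //; rewrite leq_mul2r; apply/orP; right.
exact: leq_bigmax.
Qed.

End HighDegree.

(** * Membership in the ideal of f and of the powers of the variables *)

Section TopCohomologyMembership.
Variables (A : comNzRingType) (n : nat).
Local Notation P := {mpoly A[n]}.
Variable f : P.

Definition powers_ideal (k : nat) : set P :=
  [set p | exists w (h : 'I_n -> P), p = w * f + \sum_i 'X_i ^+ k * h i].

Lemma powers_idealD k p q :
  powers_ideal k p -> powers_ideal k q -> powers_ideal k (p + q).
Proof.
move=> [w [h ->]] [w' [h' ->]]; exists (w + w'), (fun i => h i + h' i).
rewrite mulrDl addrACA -big_split; congr (_ + _).
by apply: eq_bigr => i _; rewrite mulrDr.
Qed.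

Lemma powers_ideal_mul k w : powers_ideal k (w * f).
Proof.
by exists w, (fun _ => 0); rewrite big1 ?addr0 // => i _; rewrite mulr0.
Qed.

Lemma powers_ideal_sum k (I : Type) (s : seq I) (Q : pred I) (F : I -> P) :
  (forall i, Q i -> powers_ideal k (F i)) -> powers_ideal k (\sum_(i <- s | Q i) F i).
Proof.
move=> hF; apply: (big_ind (powers_ideal k)) => //; last exact: powers_idealD.
by rewrite -(mul0r f); exact: powers_ideal_mul.
Qed.

Lemma powers_ideal_var k (i : 'I_n) (u : 'X_{1..n}) c :
  (k <= u i)%N -> powers_ideal k (c *: 'X_[u]).
Proof.
move=> ku; exists 0, (fun j => if j == i then c *: 'X_[u - U_(i) *+ k] else 0).
rewrite mul0r add0r (bigD1 i) //= eqxx big1 ?addr0 => [|j /negPf->]; last exact: mulr0.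
rewrite -scalerAr mpolyXn -mpolyXD addmC submK //; apply/mnm_lepP => j.
by rewrite mulmnE mnm1E; case: eqP => // <-; rewrite mul1n.
Qed.

Lemma powers_ideal_small k (p : P) :
  (forall u : 'X_{1..n}, (forall i, u i < k)%N -> p@_u = 0) ->
  powers_ideal k p.
Proof.
move=> hp; rewrite (mpolyE p); apply: powers_ideal_sum => u _.
have [/existsP[i ku]|/existsPn uk] := boolP [exists i, k <= u i]%N.
  exact: powers_ideal_var ku.
rewrite hp ?scale0r; last by move=> i; rewrite ltnNge uk.
by rewrite -(mul0r f); exact: powers_ideal_mul.
Qed.

Lemma mcoeff_mulX (w : P) (b v : 'X_{1..n}) :
  ('X_[b] * w)@_v = if (b <= v)%MM then w@_(v - b)%MM else 0.
Proof.
rewrite mulrC; case: ifPn => [bv|bv]; first by rewrite -{1}(submK bv) addmC mcoeffMX.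
rewrite mcoeffM big1 // => -[[v1 ?] [v2 ?]] /= /eqP vE.
rewrite mcoeffX; case: eqP => [bE|_]; last by rewrite mulr0.
by rewrite vE bE lem_addl in bv.
Qed.

(** Modulo the [y_i^k], the monomials [y^(k-1-g)], with all exponents of the
subtrahend below [k], are dual to the monomials [y^g]: the coefficient of
[y^(k-1-e)] in [f w], with [w] the sum of the [u(v) y^(k-1-v)], is the value on
[f y^e] of the linear form with values [u].  Only [|v| = d + b] is kept
in [w], so that [f w] has no term with [|e| <> d], and [k > d + b] ensures that
the truncation at the exponent [k-1] loses no term. *)
Lemma transfer_in_powers_ideal (a : A) (b d k : nat) (g : 'X_{1..n}) :
  (forall u, u \in msupp f -> mdeg u = b) -> transfer_ideal f d a ->
  mdeg g = d -> (d + b < k)%N ->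
  powers_ideal k (a *: 'X_[[multinom k.-1 | _ < n] - g]).
Proof.
move=> fb Ja gd dbk; have [u uP] := Ja g (eq_leq gd).
pose M : 'X_{1..n} := [multinom k.-1 | _ < n].
pose w : P := mpoly_of_coef (mdeg M).+1 (fun v =>
  if (v <= M)%MM && (mdeg (M - v) == (d + b)%N) then u (M - v)%MM else 0).
have wE v : w@_v = if (v <= M)%MM && (mdeg (M - v) == (d + b)%N)
    then u (M - v)%MM else 0.
  rewrite mcoeff_of_coef; case: ltnP => // Mv; case: ifP => // /andP[vM _].
  by move: Mv; rewrite -(submK vM) mdegD ltnNge leq_addl.
rewrite -(subrK (w * f) (a *: _)); apply: powers_idealD; last exact: powers_ideal_mul.
apply: powers_ideal_small => v vk.
have vM : (v <= M)%MM.
  by apply/mnm_lepP => i; rewrite mnmE -ltnS prednK // (leq_trans _ dbk).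
pose e : 'X_{1..n} := (M - v)%MM.
have gM : (g <= M)%MM.
  apply/mnm_lepP => i; have : (g i <= d)%N by rewrite -gd mdegE (bigD1 i) //= leq_addr.
  by rewrite mnmE; lia.
have coefX : (a *: 'X_[M - g] : P)@_v = a *+ (g == e).
  rewrite mcoeffZ mcoeffX mulr_natr; congr (_ *+ _); congr nat_of_bool.
  apply/eqP/eqP => [vE|->]; last by rewrite /e submBA // addmC addmK.
  by rewrite /e -vE submBA // addmC addmK.
apply/eqP; rewrite mcoeffB subr_eq0 coefX (mpolyE f) big_distrr mcoeff_sum /=.
apply/eqP; symmetry.
have MvE c : (c <= v)%MM -> (M - (v - c))%MM = (c + e)%MM.
  by move=> cv; rewrite submBA // -{1}(submK vM) -/e -addmA (addmC v) addmA addmK addmC.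
have degE c : c \in msupp f -> (c <= v)%MM ->
    w@_(v - c)%MM = if mdeg e == d then u (c + e)%MM else 0.
  move=> /fb cb cv; rewrite wE (lepm_trans (lem_subr v c) vM) /= MvE // mdegD cb.
  by rewrite addnC eqn_add2r.
have [ed|ed] := eqVneq (mdeg e) d; last first.
  rewrite (_ : g == e = false); last by apply: contraNF ed => /eqP<-; apply/eqP.
  rewrite mulr0n big1_seq // => c /andP[_ fc].
  rewrite -scalerAr mcoeffZ (mulrC w) mcoeff_mulX; case: ifP => [cv|_]; last by rewrite mulr0.
  by rewrite degE // (negPf ed) mulr0.
rewrite -uP ?ed // big_seq [RHS]big_seq; apply: eq_bigr => c fc.
have cv : (c <= v)%MM.
  apply/mnm_lepP => i.
  have ci : (c i <= b)%N by rewrite -(fb c fc) mdegE (bigD1 i) //= leq_addr.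
  have ei : (e i <= d)%N by rewrite -ed mdegE (bigD1 i) //= leq_addr.
  by move: ei; rewrite /e mnmBE mnmE; lia.
by rewrite -scalerAr mcoeffZ (mulrC w) mcoeff_mulX cv degE // ed eqxx.
Qed.

(** The condition on the degrees means that [p / (y_1 ... y_n)^k] has degree
[- n - d] in [y].  The factor [(y_1 ... y_n)^(d+b+1)] raises the common
denominator to an exponent larger than [d + b]. *)
Lemma high_multiple_in_powers_ideal (b d k : nat) (p : P) :
  (forall u, u \in msupp f -> mdeg u = b) ->
  (forall u, u \in msupp p -> (mdeg u + n + d)%N = (k * n)%N) ->
  (forall u, transfer_ideal f d p@_u) ->
  powers_ideal (d + b + k).+1 ((\prod_(i in [set: 'I_n]) 'X_i) ^+ (d + b).+1 * p).
Proof.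
move=> fb pd pJ; set k' := (d + b + k).+1.
pose U : 'X_{1..n} := [multinom (d + b).+1 | _ < n].
have -> : (\prod_(i in [set: 'I_n]) 'X_i) ^+ (d + b).+1 = 'X_[U] :> P.
  rewrite mpolyXE_id -prodrXl; apply: eq_big => [i|i _]; first by rewrite finset.in_setT.
  by rewrite mnmE.
rewrite (mpolyE p) big_distrr big_seq /=; apply: powers_ideal_sum => u pu.
rewrite -scalerAr -mpolyXD.
have [/existsP[i ki]|/existsPn ki] := boolP [exists i, k <= u i]%N.
  by apply: (powers_ideal_var (i := i)); rewrite mnmDE mnmE; lia.
have uk i : (u i < k)%N by rewrite ltnNge ki.
pose g : 'X_{1..n} := [multinom k.-1 - u i | i < n].
have gd : mdeg g = d.
  have sumE : (\sum_(i < n) (g i + u i + 1) = \sum_(i < n) k)%N.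
    by apply: eq_bigr => i _; rewrite mnmE; have := uk i; lia.
  move: sumE (pd u pu); rewrite !big_split /= !sum_nat_const !card_ord -!mdegE.
  by lia.
have -> : (U + u)%MM = ([multinom k'.-1 | _ < n] - g)%MM.
  by apply/mnmP => i; rewrite mnmDE mnmBE !mnmE; have := uk i; lia.
by apply: (transfer_in_powers_ideal fb) => //; lia.
Qed.

End TopCohomologyMembership.

Local Notation frac := Defs.frac.

(** * Vanishing of the top Cech cohomology in high degrees *)

Section TopCechCohomology.
Variables (A : comPzRingType).

Lemma frac_sum (M : lmodType A) (s : A) k (I : finType) (F : I -> M) :
  frac s (\sum_i F i) k = \sum_i frac s (F i) k.
Proof.
apply: (big_morph (fun x => frac s x k)) => [x y|]; first exact: fracD.
by apply/fracP; exists 0%N; rewrite !scaler0.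
Qed.

(** The fraction [s_i^k h_i / (s_1 ... s_n)^k] comes from the localization at the
product of the [s_j] with [j <> i]. *)
Lemma top_coboundary n (s : 'I_n -> A) (M : lmodType A) (z : cocycle s M n) k
    (h : 'I_n -> M) :
  cocycle_val z [set: 'I_n]%SET = frac _ (\sum_i s i ^+ k *: h i) k ->
  z \in @coboundary_pred A n s M n.
Proof.
have /asboolP[zdeg _] := valP z.
have zfull (S : {set 'I_n}) : #|S| = n -> S = [set: 'I_n]%SET.
  by move=> Sn; apply/eqP; rewrite eqEcard finset.subsetT cardsT card_ord Sn leqnn.
case: n s z h zdeg zfull => [|n] s z h zdeg zfull zT.
  rewrite /in_mem /=; apply/eqP/val_inj; rewrite [RHS]raddf0.
  apply: functional_extensionality_dep => S.
  have -> : S = [set: 'I_0]%SET by apply/setP => -[].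
  change (cocycle_val z [set: 'I_0]%SET = 0); rewrite zT [X in frac _ X]big_ord0.
  by apply/fracP; exists 0%N; rewrite !scaler0.
(* The signs compensate those of the differential. *)
pose sgn (i : 'I_n.+1) : A := (-1) ^+ #|[set j in [set: 'I_n.+1] | (j < i)%N]%SET|.
pose b : cochain s M := fun S =>
  if [pick i | S == [set: 'I_n.+1] :\ i]%SET is Some i
  then frac _ (sgn i *: h i) k else 0.
have bdeg : in_degree n b.
  move=> S Sn; rewrite /b; case: pickP => // i /eqP Si; case: Sn.
  by have := cardsD1 i [set: 'I_n.+1]%SET; rewrite finset.in_setT cardsT card_ord Si => -[].
apply/asboolP; exists b => //; apply: functional_extensionality_dep => S.
have [Sn|Sn] := eqVneq #|S| n.+1; last first.
  rewrite zdeg; last exact/eqP.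
  apply/esym/big1 => i iS; rewrite bdeg; last first.
    by move=> Si; case/eqP: Sn; rewrite (cardsD1 i) iS Si.
  rewrite /cech_restr -[0]/(frac _ 0 0) (loc_mapE (cech_prod s iS)) scaler0.
  by rewrite -fracZ scaler0.
rewrite (zfull _ Sn) zT frac_sum /cech_d; apply: eq_big => [i|i _].
  by rewrite finset.in_setT.
have bi : b ([set: 'I_n.+1] :\ i)%SET = frac _ (sgn i *: h i) k.
  rewrite /b; case: pickP => [j|/(_ i)]; last by rewrite eqxx.
  move=> /eqP/setP/(_ i); rewrite !inE eqxx /= andbT => /esym/negbFE/eqP <-.
  by [].
rewrite bi /cech_restr (loc_mapE (cech_prod s (finset.in_setT i))) -fracZ.
congr (frac _ _ _); rewrite -/(sgn i) !scalerA.
by rewrite mulrCA /sgn -exprD addnn -mul2n exprM sqrrN !expr1n mulr1.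
Qed.

End TopCechCohomology.

Section HypersurfaceCohomology.
Variables (K : fieldType) (m n : nat) (f : {mpoly {mpoly K[m]}[n]}).

Lemma cohomology_comp_scale (p : nat) (j i e : int) (c : {mpoly K[m]}) v :
  hypersurface_cohomology_comp f p j i v -> hom_poly e c ->
  hypersurface_cohomology_comp f p j (i + e) (c *: v).
Proof.
move=> [z zgr <-] hc; exists (c%:MP *: z).
  move=> S; have [k [r [[q qgr <-] zS]]] := zgr S.
  exists k, (quotmod_pi (principal_pred f) (c%:MP *: (q : _^o))); split.
    exists (c%:MP * q) => // b; rewrite mul_mpolyC => bq.
    have [bj hb] := qgr b (msuppZ_le bq); split=> //.
    by rewrite mcoeffZ mulrC; exact: hom_polyM.
  rewrite linearZ fracZ -zS; by [].
by rewrite linearZ.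
Qed.

(** A class is represented by a single fraction [q / (y_1 ... y_n)^k], and the
coefficients of [q] are homogeneous of degree [i].  They belong to the transfer
ideal, so that after expanding the fraction its numerator is congruent modulo
[f] to a combination of powers of the [y_l] as in [top_coboundary]. *)
Lemma cohomology_comp_eq0 (b d : nat) (j i : int) v :
  (forall u, u \in msupp f -> mdeg u = b) -> j = - (n + d)%:Z ->
  (forall p, hom_poly i p -> transfer_ideal f d p) ->
  hypersurface_cohomology_comp f n j i v -> v = 0.
Proof.
move=> fb jE iJ [z zgr <-].
suff zB : z \in @coboundary_pred _ n (fun i => 'X_i) (hypersurface f) n.
  rewrite -(raddf0 (quotmod_pi (@coboundary_pred _ n (fun i => 'X_i) (hypersurface f) n))).
  by apply/quotmod_piP; rewrite subr0.
have [k [r [[q qgr <-] zT]]] := zgr [set: 'I_n]%SET.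
have qdeg u : u \in msupp q -> (mdeg u + n + d)%N = (k * n)%N.
  by move=> /qgr[+ _]; rewrite cardsT card_ord jE; lia.
have qJ u : transfer_ideal f d q@_u.
  have [|] := boolP (u \in msupp q); first by move=> /qgr[_ /iJ].
  move=> /memN_msupp_eq0->; by case: (transfer_ideal_ideal f d).
have [w [h qE]] := high_multiple_in_powers_ideal fb qdeg qJ.
apply: (top_coboundary (k := (d + b + k).+1)
  (h := fun i => quotmod_pi (principal_pred f) (h i : _^o))).
rewrite zT -(frac_expand _ (d + b).+1) -linearZ addSn; congr (frac _ _ _).
rewrite -[_ *: _]/(_ * _) qE raddfD /= raddf_sum /=.
have -> : quotmod_pi (principal_pred f) (w * f) = 0.
  rewrite -(raddf0 (quotmod_pi (principal_pred f))); apply/quotmod_piP.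
  by rewrite subr0; apply/asboolP; exists w.
by rewrite add0r; apply: eq_bigr => l _; rewrite -linearZ.
Qed.

End HypersurfaceCohomology.

Theorem theorem5p3 (K : fieldType) (m n : nat) (f : {mpoly {mpoly K[m]}[n]}) :
  bihomogeneous f ->
  ideal_is_primary_to (@graded_max_ideal K m) (coef_ideal f) ->
  exists A B : int, forall j : int, j <= - n%:Z ->
    (regularity (hypersurface_cohomology_comp f n j) <= (- A * j + B)%:E)%E.
Proof.
move=> [a [b fab]] [_ radE].
have fb u : u \in msupp f -> mdeg u = `|b|%N by move=> /fab[<-].
have xnil (i : 'I_m) : exists k, coef_ideal f ('X_i ^+ k).
  suff : ideal_radical (coef_ideal f) 'X_i by [].
  rewrite radE.
  pose s := codom (fun i : 'I_m => 'X_i : {mpoly K[m]}).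
  have is_ : (index ('X_i : {mpoly K[m]}) s < size s)%N.
    by rewrite index_mem; apply: codom_f.
  exists (fun k => (k == Ordinal is_)%:R).
  rewrite (bigD1 (Ordinal is_)) //= eqxx mul1r nth_index ?codom_f //.
  by rewrite big1 ?addr0 // => k /negPf->; rewrite mul0r.
have [C CP] := transfer_high_degree xnil.
exists C%:Z, (C%:Z * (1 - n%:Z)) => j jn.
have [d jE] : exists d : nat, j = - (n + d)%:Z.
  by exists `|- j - n%:Z|%N; lia.
(* The slope is [C], and [C (d+1) = - C j + C (1 - n)]. *)
have -> : - C%:Z * j + C%:Z * (1 - n%:Z) = ((C * d.+1)%N%:Z + 1) - 1.
  by rewrite addrK PoszM jE; nia.
apply: regularity_lt => i e c v hv hc ie.
apply: (cohomology_comp_eq0 fb jE _ (cohomology_comp_scale hv hc)) => p hp.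
by apply: (CP d _ p hp); lia.
Qed.
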